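(* Let $n\in\mathbb{N}$ and let $\mathbf{s}=(s_0,\ldots,s_n)\subset[0,\infty)$ be positive on $(0,1]$. Set $K=\mathrm{ind}_1(\mathbf{s})$ and $N=2K-1$. Then (i) $s_k\in\big(t_1((s_{k+1},\ldots,s_n)),\infty\big)$ for $k\in\mathbb{N}\cap[n-N,n-1]$; (ii) $s_k=t_1((s_{k+1},\ldots,s_{k+N+1}))$ for $k\in\mathbb{N}\cap[0,n-N-1]$.
   Context: For $a<b$ and a finite sequence $\mathbf{u}=(u_0,\ldots,u_m)$, $\mathbf{u}$ is positive on $[a,b]$ if the functional $\sigma(x^k)=u_k$ is $\ge0$ on every real polynomial of degree $\le m$ nonnegative on $[a,b]$; positive on $(0,1]$ means positive on some $[a,b]$ with $0<a<b\le1$. $\mathcal{M}_{a,b}(\mathbf{u})$ is the set of positive Borel measures on $[a,b]$ with $k$-th moments $u_k$; $\mathcal{M}_1(\mathbf{u})$ is the set of positive Borel measures on $(0,1]$ supported in some $[a,b]\subset(0,1]$, $a>0$, with these moments. For finitely supported $\mu$, $\mathrm{ind}_1(\mu)=\#(\mathrm{supp}\,\mu\cap(0,1))+\frac12\chi_{\mathrm{supp}\,\mu}(1)$, else $\infty$; $\mathrm{ind}_1(\mathbf{u})=\min\{\mathrm{ind}_1(\mu):\mu\in\mathcal{M}_1(\mathbf{u})\}$ (a half-integer or integer). $t_{a,b}(\mathbf{u})=\inf\{\int\frac1t\,d\mu:\mu\in\mathcal{M}_{a,b}(\mathbf{u})\}$ ($\inf\varnothing=\infty$) and $t_1(\mathbf{u})=\inf_{0<a<b\le1}t_{a,b}(\mathbf{u})$.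 *)

(* Defs.v *)
From HB Require Import structures.
From mathcomp Require Import all_boot all_order all_algebra.
From mathcomp Require Import all_classical all_reals all_analysis.
Set Implicit Arguments. Unset Strict Implicit. Unset Printing Implicit Defensive.
Import Order.TTheory GRing.Theory Num.Theory.
Import numFieldNormedType.Exports.
Local Open Scope classical_set_scope.
Local Open Scope ring_scope.

Section Defs.
Variable R : realType.
Local Notation mR := (measurableTypeR R).

(* A finite sequence u = (u_0,...,u_m) is a list of length m+1. *)

(* u is positive on [a,b]: the Riesz functional sigma(x^k) = u_k is >= 0 on
   every real polynomial of degree <= m that is nonnegative on [a,b]. *)
Definition positive_on (a b : R) (u : seq R) : Prop :=
  forall p : {poly R}, (size p <= size u)%N ->
    (forall x : R, a <= x <= b -> 0 <= p.[x]) ->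
    0 <= \sum_(k < size u) p`_k * u`_k.

Definition positive_on01 (u : seq R) : Prop :=
  exists a b : R, [/\ 0 < a, a < b, b <= 1 & positive_on a b u].

(* M_{a,b}(u): positive Borel measures on [a,b] (i.e. Borel measures on R
   vanishing outside [a,b]) whose k-th moments are u_k. *)
Definition Mab (a b : R) (u : seq R) (mu : {measure set mR -> \bar R}) : Prop :=
  mu (~` `[a, b]%classic) = 0%E /\
  forall k : nat, (k < size u)%N ->
    (\int[mu]_(x in `[a, b]%classic) (x ^+ k)%:E = (u`_k)%:E)%E.

Definition M1 (u : seq R) (mu : {measure set mR -> \bar R}) : Prop :=
  exists a b : R, [/\ 0 < a, a < b, b <= 1 & Mab a b u mu].

Definition fin_supp (mu : {measure set mR -> \bar R}) (S : seq R) : Prop :=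
  [/\ uniq S,
      (forall x : R, x \in S <-> (0 < mu [set x])%E) &
      mu (~` [set x | x \in S]) = 0%E].

(* Twice ind_1 of a finitely supported measure with support S:
   2 * #(S cap (0,1)) + chi_S(1). *)
Definition ind1x2_supp (S : seq R) : nat :=
  let open01 := [seq x <- S | (0 < x) && (x < 1)] in
  let has1 : bool := (1 : R) \in S in
  (2 * size open01 + has1)%N.

Definition ind1x2_set (u : seq R) : set nat :=
  [set d | exists (mu : {measure set mR -> \bar R}) (S : seq R),
     [/\ M1 u mu, fin_supp mu S & d = ind1x2_supp S]].

(* 2 * ind_1(u) = the minimum of the above set (ind_1 is a half-integer).
   If the set were empty (ind_1(u) = oo) we default to 0; under the
   hypotheses of the theorem the set is nonempty. *)
Definition ind1x2 (u : seq R) : nat :=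
  match pselect (exists d, `[< ind1x2_set u d >]) with
  | left h => ex_minn h
  | right _ => 0%N
  end.

(* t_{a,b}(u) = inf { int 1/t dmu : mu in M_{a,b}(u) }, inf of empty = +oo *)
Definition t_ab (a b : R) (u : seq R) : \bar R :=
  ereal_inf [set (\int[mu]_(x in `[a, b]%classic) (x^-1)%:E)%E
            | mu in [set mu | Mab a b u mu]].

Definition t_1 (u : seq R) : \bar R :=
  ereal_inf [set t_ab ab.1 ab.2 u
            | ab in [set ab : R * R | [/\ 0 < ab.1, ab.1 < ab.2 & ab.2 <= 1]]].

Definition subseqR (s : nat -> R) (i l : nat) : seq R := [seq s j | j <- iota i l].

End Defs.

(* Main.v *)
(** A positive truncated sequence [s] is represented by an atomic measure: the
cone of moment vectors of at most n + 2 atoms has a point closest to [s], and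
the residual at that point, read as a polynomial, contradicts positivity unless
it vanishes. Let then [S] and [w] be the atoms and weights of a representing
measure of index [K].

For (ii), let [r(t)] be the product of [(1 - t/x)^2] over the atoms [x < 1],
times [1 - t] if 1 is an atom. Then [r(0) = 1], [r >= 0] on ]0, 1], and
[q(t) = (1 - r(t))/t] has degree less than [2K], lies below [1/t] on ]0, 1] and
agrees with it on [S]; so [x^(k+1) w] minimises the integral of [1/t].

For (i), at most [2K] points [x_0 < y_0 < x_1 < y_1 < ...] can be chosen with
the [x_i] in [S]. The Lagrange weights at 0 of these nodes alternate in sign,
starting positive, and kill the monomials of positive degree; subtracting a
small multiple of them decreases the integral of [1/t] and nothing else, and
mass is only removed at points of [S]. *)

Require Import Defs.
From HB Require Import structures.
From mathcomp Require Import all_boot all_order all_algebra.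
From mathcomp Require Import all_classical all_reals all_analysis.
From mathcomp Require Import measurable_realfun ring lra.
Import Order.TTheory GRing.Theory Num.Theory.
Import numFieldNormedType.Exports.
Local Open Scope classical_set_scope.
Local Open Scope ring_scope.

(** * Lagrange weights at 0 and interlacing nodes *)

Lemma size_prod_le {R : nzRingType} {I : Type} (d : nat) (s : seq I)
    (F : I -> {poly R}) :
  (forall i, size (F i) <= d.+1)%N ->
  (size (\prod_(i <- s) F i)%R <= (d * size s).+1)%N.
Proof.
move=> Fd; elim: s => [|y s IH]; first by rewrite big_nil size_poly1 muln0.
rewrite big_cons; apply: (leq_trans (size_polyMleq _ _)) => /=.
rewrite -subn1 leq_subLR (leq_trans (leq_add (Fd y) IH))//.
by rewrite mulnS addSn addnS add1n.
Qed.

(* Lagrange interpolation of ['X^i] at the nodes [P], evaluated at 0. *)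
Lemma lagrange_at0 {R : fieldType} (P : seq R) (i : nat) :
  uniq P -> (i < size P)%N ->
  \sum_(x <- P) x ^+ i * \prod_(y <- P | y != x) (y / (y - x)) = (i == 0%N)%:R.
Proof.
move=> uP iP.
pose L x : {poly R} := \prod_(y <- P | y != x) ((y - x)^-1 *: (y%:P - 'X)).
have Lz x z : (L x).[z] = \prod_(y <- P | y != x) ((y - z) / (y - x)).
  rewrite horner_prod; apply: eq_bigr => y _.
  by rewrite hornerZ hornerD hornerN hornerC hornerX mulrC.
have sL x : x \in P -> (size (L x) <= size P)%N.
  move=> xP; rewrite /L -big_filter.
  apply: (leq_trans (size_prod_le 1 _ _ _)).
    move=> y; apply: (leq_trans (size_scale_leq _ _)).
    by rewrite -opprB size_polyN size_XsubC.
  by rewrite mul1n -rem_filter// size_rem// prednK//; case: (P) xP.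
(* The interpolation error has degree below [size P] and vanishes on all of [P], so it is zero. *)
pose f : {poly R} := 'X^i - \sum_(x <- P) (x ^+ i) *: L x.
have f0 : f = 0.
  apply: (@roots_geq_poly_eq0 _ f P) => //.
    apply/allP => z zP; apply/rootP.
    rewrite /f hornerD hornerN hornerXn horner_sum (bigD1_seq z)//= hornerZ Lz.
    rewrite big1_seq => [|y /andP[yz _]]; last first.
      by rewrite divff// subr_eq0.
    rewrite mulr1 opprD addrA subrr sub0r.
    rewrite big1_seq ?oppr0// => x /andP[xz xP].
    rewrite hornerZ Lz -big_filter (bigD1_seq z) ?filter_uniq//=.
      by rewrite subrr !mul0r mulr0.
    by rewrite mem_filter eq_sym xz.
  apply: (leq_trans (size_polyD _ _)); rewrite geq_max size_polyXn iP/= size_polyN.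
  rewrite big_seq; apply: (big_ind (fun p : {poly R} => (size p <= size P)%N)).
  - by rewrite size_poly0.
  - by move=> p q hp hq; apply: (leq_trans (size_polyD _ _)); rewrite geq_max hp hq.
  by move=> x xP; exact: (leq_trans (size_scale_leq _ _) (sL _ xP)).
have := congr1 (fun p : {poly R} => p.[0]) f0.
rewrite /f hornerD hornerN hornerXn horner0 horner_sum expr0n => /eqP.
rewrite subr_eq0 => /eqP ->; apply: eq_bigr => x _; rewrite hornerZ Lz.
by congr (_ * _); apply: eq_bigr => y _; rewrite subr0.
Qed.

(** The factor [y / (y - x)] is negative exactly for the nodes [y] below [x]. *)
Lemma lagrange_weight_sign {R : realFieldType} (P : seq R) (x : R) :
  (forall y, y \in P -> 0 < y) ->
  0 <= (-1) ^+ count (< x) P * \prod_(y <- P | y != x) (y / (y - x)).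
Proof.
elim: P => [|z P IH] P0; first by rewrite big_nil mulr1 ler01.
have {}IH := IH (fun y yP => P0 y (mem_behead (s := z :: P) yP)).
have z0 : 0 < z by apply: P0; rewrite mem_head.
rewrite big_cons /=; case: (ltgtP z x) => [zx|xz|_] //=.
- rewrite add1n exprS mulN1r mulrCA mulNr mulrN -mulNr.
  by rewrite -mulrN -invrN opprB mulr_ge0// divr_ge0// ?subr_ge0 ltW.
- by rewrite add0n mulrCA mulr_ge0// divr_ge0// ?subr_ge0 ltW.
Qed.

(* [P] is the initial part of [x_0 < y_0 < x_1 < y_1 < ...], where the [x_i]
   enumerate [xs] and [y_i] lies between [x_i] and [x_(i+1)] (or 1). *)
Lemma interlacing {R : realType} (M : nat) (xs : seq R) :
  sorted <%O xs -> (forall x, x \in xs -> 0 < x <= 1) -> (M <= ind1x2_supp xs)%N ->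
  exists P : seq R, [/\ uniq P, size P = M,
    forall y, y \in P -> y <= 1,
    forall z, (forall x, x \in xs -> z <= x) -> forall y, y \in P -> z <= y &
    forall y, y \in P -> y \notin xs -> odd (count (< y) P)].
Proof.
(* The recursion adds an atom and a gap point at once, so it descends by two. *)
elim/ltn_ind: M xs => -[|[|M]] IH [|x xs] sxs xs01 HM.
- by exists [::].
- by exists [::].
- by [].
- exists [:: x]; split=> //.
  + by move=> y; rewrite inE => /eqP ->; case/andP: (xs01 x (mem_head _ _)).
  + by move=> z zx y; rewrite inE => /eqP ->; apply: zx; rewrite mem_head.
  + by move=> y; rewrite inE => /eqP ->; rewrite mem_head.
- by [].
have /andP[x0 x1] := xs01 x (mem_head _ _).
have ltx z : z \in xs -> x < z.
  by move: sxs; rewrite /= (path_sortedE lt_trans) => /andP[/allP h _] /h.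
(* An [x] equal to 1 would be the only atom, of doubled index 1. *)
have x_lt1 : x < 1.
  rewrite lt_neqAle x1 andbT; apply/eqP => xE.
  have xs0 : xs = [::].
    case: xs ltx xs01 {sxs HM} => // z xs ltx xs01.
    have := ltx z (mem_head _ _); have := xs01 z; rewrite !inE eqxx orbT.
    by rewrite xE => /(_ isT) /andP[_]; case: ltgtP.
  by move: HM; rewrite xs0 xE /ind1x2_supp /= ltxx andbF /= inE eqxx.
have sxs' : sorted <%O xs by move: sxs => /=; exact: path_sorted.
have K2E : ind1x2_supp (x :: xs) = (2 + ind1x2_supp xs)%N.
  rewrite /ind1x2_supp /= x0 x_lt1 /= inE (gt_eqF x_lt1) /=.
  by rewrite mulnS -addnA.
have xs01' z : z \in xs -> 0 < z <= 1.
  by move=> zxs; apply: xs01; rewrite inE zxs orbT.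
have HM' : (M <= ind1x2_supp xs)%N by move: HM; rewrite K2E !add2n !ltnS.
have [P [uP sP P1 Pge Podd]] := IH M (leqW (leqnn _)) xs sxs' xs01' HM'.
(* [h] is the next atom, or 1 if there is none; with [z = h], the lower bound in the induction
   hypothesis puts [P] above [m]. *)
pose h := head 1 xs; pose m := (x + h) / 2.
have xh : x < h by rewrite /h; case: (xs) ltx => //= z l -> //; rewrite mem_head.
have h1 : h <= 1.
  rewrite /h; case: (xs) xs01 => //= z l /(_ z).
  by rewrite !inE eqxx orbT => /(_ isT) /andP[].
have hle z : z \in xs -> h <= z.
  rewrite /h; move: sxs'; case: (xs) => //= c l.
  rewrite (path_sortedE lt_trans) => /andP[/allP cl _].
  by rewrite inE => /predU1P[->//|/cl /ltW].
have xm : x < m by rewrite /m; lra.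
have mh : m < h by rewrite /m; lra.
have mP y : y \in P -> m < y by move=> yP; apply: (lt_le_trans mh); apply: Pge yP.
have xP y : y \in P -> x < y by move=> /mP; apply: lt_trans.
exists [:: x, m & P]; split.
- rewrite /= uP andbT inE (lt_eqF xm) /=; apply/andP; split.
    by apply/negP => /xP; rewrite ltxx.
  by apply/negP => /mP; rewrite ltxx.
- by rewrite /= sP.
- by move=> y; rewrite !inE => /or3P[/eqP->//|/eqP->|/P1//]; lra.
- move=> z zx; have zlex : z <= x by apply: zx; rewrite mem_head.
  move=> y; rewrite !inE => /or3P[/eqP->//|/eqP->|/xP xy]; first lra.
  exact: le_trans zlex (ltW xy).
- move=> y; rewrite !inE => /or3P[/eqP->|/eqP->|yP]; first by rewrite eqxx.
    move=> _ /=; rewrite xm ltxx add0n.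
    rewrite (@eq_in_count _ _ pred0) ?count_pred0// => z /mP zm /=.
    by apply/negbTE; rewrite -leNgt ltW.
  rewrite negb_or => /andP[_ yxs] /=.
  by rewrite (xP _ yP) (mP _ yP) !add1n /= negbK Podd.
Qed.

(** As [f x > 0], an admissible step stays admissible when shortened ([mono]), so the least step
    over the finite list works for all. *)
Lemma perturbation_ge0 {R : realFieldType} (S : seq R) (f g : R -> R) :
  (forall x, x \in S -> 0 < f x) ->
  exists2 e, 0 < e & forall x, x \in S -> 0 <= f x + e * g x.
Proof.
elim: S => [|z S IH] f0; first by exists 1.
have [x xS|e e0 he] := IH; first by apply: f0; rewrite inE xS orbT.
have fz : 0 < f z by apply: f0; rewrite mem_head.
pose d := f z / (1 + `|g z|).
have g1 : 0 < 1 + `|g z| by rewrite ltr_pwDl.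
have d0 : 0 < d by rewrite divr_gt0.
have mono x (e1 e2 : R) : 0 < f x -> 0 <= e1 <= e2 ->
    0 <= f x + e2 * g x -> 0 <= f x + e1 * g x.
  by move=> fx /andP[e10 e12] h2; case: (lerP 0 (g x)) => gx; nra.
exists (Num.min e d); first by rewrite lt_min e0.
move=> x; rewrite inE => /predU1P[->|xS].
  apply: (mono _ _ d fz); first by rewrite le_min (ltW e0) (ltW d0) ge_min lexx orbT.
  have dE : d * (1 + `|g z|) = f z by rewrite /d divfK ?gt_eqF.
  have := ler_norm (- g z); rewrite normrN => gz.
  by rewrite -dE -mulrDr mulr_ge0 ?(ltW d0)//; lra.
apply: (mono _ _ e); first by apply: f0; rewrite inE xS orbT.
  by rewrite le_min (ltW e0) (ltW d0) ge_min lexx.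
exact: he.
Qed.

(** * Atomic measures and bounds on [t_1] *)

Lemma measurable_expr_itv {R : realType} (a b : R) (k : nat) :
  measurable_fun (`[a, b]%classic : set (measurableTypeR R)) (fun x : R => (x ^+ k)%:E).
Proof.
apply/measurable_EFinP; apply: (@measurable_funS _ _ _ _ setT) => //.
Qed.

Lemma measurable_inv_itv {R : realType} (a b : R) : 0 < a ->
  measurable_fun (`[a, b]%classic : set (measurableTypeR R)) (fun x : R => (x^-1)%:E).
Proof.
move=> a0; apply/measurable_EFinP; apply: subspace_continuous_measurable_fun => //.
have c : {in `[a, b]%classic, continuous (fun x : R => x^-1)}.
  move=> x; rewrite inE/= in_itv/= => /andP[ax _].
  by apply: inv_continuous; rewrite gt_eqF// (lt_le_trans a0).
exact: continuous_in_subspaceT c.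
Qed.

(** The absolute value makes this a measure for every [w]; it disappears when the weights are
    nonnegative. *)
Definition atomic {R : realType} (N : nat) (x w : nat -> R)
    : {measure set (measurableTypeR R) -> \bar R} :=
  msum (fun i => mscale `|w i|%:nng (@dirac _ (measurableTypeR R) (x i) R)) N.

Section atomic.
Context {R : realType} (N : nat) (x w : nat -> R).
Hypothesis w0 : forall i, (i < N)%N -> 0 <= w i.

Lemma atomicE (A : set R) :
  atomic N x w A = (\sum_(i < N) (w i * \1_A (x i)))%:E.
Proof.
rewrite /atomic /= /msum -sumEFin; apply: eq_bigr => i _ /=.
by rewrite /mscale /= ger0_norm ?w0.
Qed.

Lemma integral_atomic (D : set (measurableTypeR R)) (f : R -> R) :
  measurable D -> measurable_fun D (fun x => (f x)%:E) ->
  (forall y, D y -> 0 <= f y) -> (forall i, (i < N)%N -> D (x i)) ->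
  (\int[atomic N x w]_(y in D) (f y)%:E)%E = (\sum_(i < N) w i * f (x i))%:E.
Proof.
move=> mD mf f0 Dx; rewrite /atomic ge0_integral_measure_sum// -sumEFin.
apply: eq_bigr => i _ /=.
rewrite ge0_integral_mscale//= integral_dirac// diracE mem_set ?mul1e; last exact: Dx.
by rewrite ger0_norm ?w0.
Qed.

Lemma atomic_Mab (a b : R) (u : seq R) :
  0 < a -> (forall i, (i < N)%N -> a <= x i <= b) ->
  (forall k, (k < size u)%N -> u`_k = \sum_(i < N) w i * x i ^+ k) ->
  Mab a b u (atomic N x w).
Proof.
move=> a0 xab uE; split.
  rewrite atomicE big1// => i _; rewrite indicE memNset ?mulr0// => -[].
  by rewrite /= in_itv /= xab.
move=> k ku; rewrite uE// (integral_atomic _ (fun y => y ^+ k))//.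
- exact: measurable_expr_itv.
- move=> y /=; rewrite in_itv/= => /andP[ay _].
  by rewrite exprn_ge0// ltW// (lt_le_trans a0).
Qed.

End atomic.

(** The atoms form a competitor in [Mab a 1 u]. Weights may vanish, so [T] can exceed the
    support. *)
Lemma t_1_le {R : realType} (a : R) (u T : seq R) (w : R -> R) :
  0 < a -> a < 1 -> (forall x, x \in T -> a <= x <= 1) ->
  (forall x, x \in T -> 0 <= w x) ->
  (forall k, (k < size u)%N -> u`_k = \sum_(x <- T) w x * x ^+ k) ->
  (t_1 u <= (\sum_(x <- T) w x * x^-1)%:E)%E.
Proof.
move=> a0 a1 Ta w0 uE.
pose x i : R := nth 0 T i; pose N := size T.
have sumE (f : R -> R) : \sum_(x <- T) w x * f x = \sum_(i < N) w (x i) * f (x i).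
  by rewrite (big_nth 0) big_mkord.
have w0' i : (i < N)%N -> 0 <= w (x i) by move=> iN; apply/w0/mem_nth.
have xa i : (i < N)%N -> a <= x i <= 1 by move=> iN; apply/Ta/mem_nth.
have hM : Mab a 1 u (atomic N x (w \o x)).
  by apply: atomic_Mab => // k ku; rewrite uE// (sumE (fun y => y ^+ k)).
have -> : (\sum_(x <- T) w x * x^-1)%:E =
    (\int[atomic N x (w \o x)]_(y in `[a, 1%R]%classic) (y^-1)%:E)%E.
  rewrite (integral_atomic _ _ _ _ _ (fun y => y^-1))// ?(sumE (fun y => y^-1))//.
  - exact: measurable_inv_itv.
  - move=> y /=; rewrite in_itv/= => /andP[ay _].
    by rewrite invr_ge0 ltW// (lt_le_trans a0).
apply: (@le_trans _ _ (t_ab a 1 u)).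
  by apply: ereal_inf_lbound; exists (a, 1) => //; split.
by apply: ereal_inf_lbound; exists (atomic N x (w \o x)).
Qed.

Lemma fin_supp_integral {R : realType} (mu : {measure set (measurableTypeR R) -> \bar R})
    (S : seq R) (D : set (measurableTypeR R)) (f : R -> R) :
  fin_supp mu S -> measurable D -> (forall x, x \in S -> D x) ->
  measurable_fun D (fun x => (f x)%:E) -> (forall y, D y -> 0 <= f y) ->
  (\int[mu]_(y in D) (f y)%:E = \sum_(x <- S) (f x)%:E * mu [set x])%E.
Proof.
move=> [uS _ muS] mD SD mf f0.
have US : [set` S] = \big[setU/set0]_(x <- S) [set x].
  rewrite -bigcup_seq; apply/seteqP; split=> [y /= yS|y [z /= zS ->]//].
  by exists y.
have mS : measurable ([set` S] : set (measurableTypeR R)).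
  by rewrite US; apply: bigsetU_measurable => i _; exact: measurable_set1.
rewrite (ge0_negligible_integral _ mD mf _ muS)//; last exact: measurableC.
have -> : D `\` ~` [set` S] = \big[setU/set0]_(x <- S) [set x].
  rewrite -US setDE setCK; apply/seteqP; split=> [y []//|y yS]; split=> //.
  exact: SD.
rewrite ge0_integral_bigsetU//=.
- apply: eq_bigr => x _.
  have -> : (\int[mu]_(y in [set x]) (f y)%:E = \int[mu]_(y in [set x]) cst (f x)%:E y)%E.
    by apply: eq_integral => y; rewrite inE /= => ->.
  by rewrite integral_cst.
- by apply/trivIsetP => i j _ _ ij; apply/seteqP; split=> // z [/= -> /eqP]; apply/negP.
- rewrite -US; apply: measurable_funS mf => //.
- by move=> y; rewrite -US => /SD /f0.
Qed.

Lemma fin_supp_moments {R : realType} (mu : {measure set (measurableTypeR R) -> \bar R})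
    (u S : seq R) : (0 < size u)%N -> M1 u mu -> fin_supp mu S ->
  exists (a : R) (w : R -> R), [/\ 0 < a, a < 1,
    forall x, x \in S -> a <= x <= 1, forall x, x \in S -> 0 < w x &
    forall k, (k < size u)%N -> u`_k = \sum_(x <- S) w x * x ^+ k].
Proof.
move=> u0 [a [b [a0 ab b1 [mu0 muE]]]] hS; have [uS Smu _] := hS.
have Sab x : x \in S -> a <= x <= b.
  move=> /Smu mux; apply/negPn/negP => xab.
  have : (mu [set x] <= mu (~` `[a, b]%classic))%E.
    apply: le_measure; rewrite ?inE//; first exact: measurableC.
    by move=> y /= ->; rewrite in_itv /=; apply/negP.
  by rewrite mu0 leNgt mux.
have finS x : x \in S -> mu [set x] \is a fin_num.
  move=> xS; rewrite ge0_fin_numE//.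
  (* The zeroth moment is the mass of the interval; it bounds every atom, so [fine] loses
     nothing. *)
  have muab : mu `[a, b]%classic = (u`_0)%:E.
    have := muE 0%N u0; under eq_integral do rewrite expr0.
    by rewrite integral_cst// mul1e.
  apply: (@le_lt_trans _ _ (mu `[a, b]%classic)); last by rewrite muab ltry.
  by apply: le_measure; rewrite ?inE// => y /= ->; rewrite in_itv /= Sab.
exists a, (fun x => fine (mu [set x])); split=> //.
- exact: lt_le_trans ab b1.
- by move=> x /Sab /andP[-> xb] /=; apply: le_trans b1.
- by move=> x xS; rewrite fine_gt0//; move/Smu: (xS) => -> /=; rewrite -ge0_fin_numE ?finS.
move=> k ku; apply: EFin_inj; rewrite -muE//.
rewrite (fin_supp_integral _ _ _ (fun y => y ^+ k) hS)//.
- rewrite -sumEFin big_seq [RHS]big_seq; apply: eq_bigr => x xS.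
  by rewrite EFinM fineK ?finS// muleC.
- exact: measurable_expr_itv.
- move=> y /=; rewrite in_itv/= => /andP[ay _].
  by rewrite exprn_ge0// ltW// (lt_le_trans a0).
Qed.

(** Weak duality: the moments determine the integral of [q] against any competitor, and [q] lies
    below [1/x]. *)
Lemma t_1_ge {R : realType} (u : seq R) (q : {poly R}) :
  (size q <= size u)%N -> (forall x, 0 < x <= 1 -> q.[x] <= x^-1) ->
  ((\sum_(k < size u) q`_k * u`_k)%:E <= t_1 u)%E.
Proof.
move=> sq qle; apply: le_ereal_inf_tmp => _ [[a b] [/= a0 ab b1] <-].
apply: le_ereal_inf_tmp => _ [mu [_ muE] <-].
have mD : measurable (`[a, b]%classic : set (measurableTypeR R)) by [].
(* Without moments the mass may be infinite, but then the bound is 0 and [1/x >= 0] suffices. *)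
have [u0|u0] := leqP (size u) 0.
  rewrite big1 => [|[k ku]]; last by move: (leq_trans ku u0).
  apply: integral_ge0 => y /=; rewrite in_itv/= => /andP[ay _].
  by rewrite lee_fin invr_ge0 ltW// (lt_le_trans a0).
have intX k : (k < size u)%N -> mu.-integrable `[a, b]%classic (fun x => (x ^+ k)%:E).
  move=> ku; apply/integrableP; split; first exact: measurable_expr_itv.
  have -> : (\int[mu]_(x in `[a, b]%classic) `|(x ^+ k)%:E| =
             \int[mu]_(x in `[a, b]%classic) (x ^+ k)%:E)%E.
    apply: eq_integral => y; rewrite inE/= in_itv/= => /andP[ay _].
    by rewrite ger0_norm// exprn_ge0// ltW// (lt_le_trans a0).
  by rewrite muE// ltry.
have muab : mu `[a, b]%classic = (u`_0)%:E.
  have := muE 0%N u0; under eq_integral do rewrite expr0.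
  by rewrite integral_cst// mul1e.
have intV : mu.-integrable `[a, b]%classic (fun x => (x^-1)%:E).
  apply: (@le_integrable _ _ _ mu _ mD _ (cst (a^-1)%:E)).
  - exact: measurable_inv_itv.
  - move=> y /=; rewrite in_itv/= => /andP[ay _].
    rewrite lee_fin !ger0_norm ?invr_ge0 ?(ltW a0) ?(ltW (lt_le_trans a0 ay))//.
    by rewrite lef_pV2 ?posrE// (lt_le_trans a0).
  - apply/integrableP; split; first exact: measurable_cst.
    by under eq_integral do rewrite /=; rewrite integral_cst// muab -EFinM ltry.
pose F (k : 'I_(size u)) (x : R) : \bar R := ((q`_k)%:E * (x ^+ k)%:E)%E.
have intF k : mu.-integrable `[a, b]%classic (F k).
  by apply: integrableZl => //; exact: intX.
have -> : ((\sum_(k < size u) q`_k * u`_k)%:E =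
    \int[mu]_(x in `[a, b]%classic) (\sum_(k < size u) F k x))%E.
  rewrite integral_sum// -sumEFin; apply: eq_bigr => k _.
  by rewrite integralZl// ?muE//; exact: intX.
apply: le_integral => //; first exact: integrable_sum.
move=> x; rewrite inE/= in_itv/= => /andP[ax xb].
rewrite /F; under eq_bigr do rewrite -EFinM.
rewrite sumEFin lee_fin -(horner_coef_wide x sq); apply: qle.
by rewrite (lt_le_trans a0 ax) (le_trans xb b1).
Qed.

(** * The cone of truncated moment vectors *)

(** The [m + 1] vectors of the first [m] powers are linearly dependent; moving the weights along a
    dependency until one of them vanishes frees an atom. *)
Lemma caratheodory_moments {R : realFieldType} (m : nat) (x w : 'I_m.+1 -> R) :
  (forall i, 0 <= w i) ->
  exists (v : 'I_m.+1 -> R) (i0 : 'I_m.+1), [/\ forall i, 0 <= v i, v i0 = 0 &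
    forall k, (k < m)%N -> \sum_i v i * x i ^+ k = \sum_i w i * x i ^+ k].
Proof.
move=> w0; pose A : 'M[R]_(m.+1, m) := \matrix_(i, k) x i ^+ k.
have [d [i1 di1 dA]] : exists d : 'I_m.+1 -> R, exists2 i1, 0 < d i1 &
    forall k, (k < m)%N -> \sum_i d i * x i ^+ k = 0.
  have : kermx A != 0 by rewrite kermx_eq0 /row_free neq_ltn ltnS rank_leq_col.
  case/rowV0Pn => v /sub_kermxP vA v0.
  have vE k : (k < m)%N -> \sum_i v 0 i * x i ^+ k = 0.
    move=> km; have := congr1 (fun M : 'rV_m => M 0 (Ordinal km)) vA.
    by rewrite !mxE => vk; rewrite -[RHS]vk; apply: eq_bigr => i _; rewrite mxE.
  have /rV0Pn[i vi0] := v0; have [vi|vi|vi] := ltgtP (v 0 i) 0.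
  - exists (fun i => - v 0 i), i; first by rewrite oppr_gt0.
    by move=> k /vE h; under eq_bigr do rewrite mulNr; rewrite sumrN h oppr0.
  - by exists (fun i => v 0 i), i.
  - by rewrite vi eqxx in vi0.
pose t i := w i / d i.
(* The least ratio [w i / d i] over [d i > 0] is the largest step that keeps all weights
   nonnegative. *)
have [i0 di0 tmin] := @arg_minP _ _ _ i1 (fun i => 0 < d i) t di1.
have t0 : 0 <= t i0 by rewrite divr_ge0// ltW.
exists (fun i => w i - t i0 * d i), i0; split.
- move=> i; rewrite subr_ge0; have [di|di] := ltP 0 (d i).
    by rewrite -ler_pdivlMr// tmin.
  by apply: le_trans (w0 i); rewrite mulr_ge0_le0.
- by rewrite /t divfK ?subrr// gt_eqF.
move=> k km; under eq_bigr do rewrite mulrBl -mulrA.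
by rewrite sumrB -mulr_sumr dA// mulr0 subr0.
Qed.

(* [m + 1] atoms are one more than Caratheodory's bound, so that one of them can
   always be freed. *)
Definition moment_cone {R : realType} (a b : R) (m : nat) (p : nat -> R) : Prop :=
  exists x w : 'I_m.+1 -> R, [/\ forall i, a <= x i <= b, forall i, 0 <= w i &
    forall k, (k < m)%N -> p k = \sum_i w i * x i ^+ k].

Lemma moment_coneZ {R : realType} (a b : R) (m : nat) (p : nat -> R) (t : R) :
  0 <= t -> moment_cone a b m p -> moment_cone a b m (fun k => t * p k).
Proof.
move=> t0 [x [w [xab w0 pE]]]; exists x, (fun i => t * w i); split=> //.
  by move=> i; rewrite mulr_ge0.
by move=> k km; rewrite pE// mulr_sumr; apply: eq_bigr => i _; rewrite mulrA.
Qed.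

Lemma moment_coneD {R : realType} (a b : R) (m : nat) (p : nat -> R) (y t : R) :
  a <= y <= b -> 0 <= t -> moment_cone a b m p ->
  moment_cone a b m (fun k => p k + t * y ^+ k).
Proof.
move=> yab t0 [x [w [xab w0 pE]]].
have [v [i0 [v0 vi0 vE]]] := caratheodory_moments _ x _ w0.
exists (fun i => if i == i0 then y else x i), (fun i => if i == i0 then t else v i).
split; [by move=> i; case: eqP | by move=> i; case: eqP |].
move=> k km; rewrite pE// -vE// (bigD1 i0)//= vi0 mul0r add0r.
rewrite [RHS](bigD1 i0)//= eqxx addrC; congr (_ + _).
by apply: eq_bigr => i /negbTE ->.
Qed.

(** First-order condition at a minimum: for small [e] the linear term decides the sign. *)
Lemma quadratic_ge0 {R : realFieldType} (A C : R) : 0 <= C ->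
  (forall e, 0 <= e <= 1 -> 0 <= e * A *+ 2 + e ^+ 2 * C) -> 0 <= A.
Proof.
move=> C0 h; rewrite leNgt; apply/negP => A0.
(* For [A < 0], [D] exceeds both [- A] and [C]: the former gives [e <= 1], the latter
   [e * C < - A]. *)
pose D := C + 1 - A; pose e := - A / D.
have D0 : 0 < D by rewrite /D; lra.
have e0 : 0 < e by rewrite /e divr_gt0// oppr_gt0.
have eD : e * D = - A by rewrite /e divfK// gt_eqF.
have e1 : e <= 1 by rewrite /e ler_pdivrMr// /D; lra.
have := h e; rewrite e1 (ltW e0) => /(_ isT).
have -> : e * A *+ 2 + e ^+ 2 * C = e * (A *+ 2 + e * C) by ring.
rewrite pmulr_rge0// /D in eD *; nra.
Qed.

(** Atoms range over a compact interval; weights can be confined to one as well, since a large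
    weight leaves the zero vector closer to [u]. A continuous function is then minimised over a
    compact box. *)
Lemma moment_cone_closest {R : realType} (a b : R) (m : nat) (u : nat -> R) :
  a <= b -> exists2 p, moment_cone a b m p &
    forall q, moment_cone a b m q ->
      \sum_(k < m) (u k - p k) ^+ 2 <= \sum_(k < m) (u k - q k) ^+ 2.
Proof.
move=> ab; pose N := m.+1.
pose X (z : 'rV[R]_(N + N)) i : R := z ord0 (lshift N i).
pose W (z : 'rV[R]_(N + N)) i : R := z ord0 (rshift N i).
pose P z k := \sum_i W z i * X z i ^+ k.
pose F z := \sum_(k < m) (u k - P z k) ^+ 2.
pose Q := \sum_(k < m) u k ^+ 2.
have Q0 : 0 <= Q by apply: sumr_ge0 => k _; rewrite sqr_ge0.
(* A weight above [B] forces an error of at least [Q + 1] in the zeroth moment, and [(Q + 1)^2]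
   exceeds the squared distance [Q] from [u] to 0. *)
pose B : R := `|u 0%N| + Q + 1.
have B0 : 0 <= B by rewrite /B !addr_ge0.
pose box (j : 'I_(N + N)) : set R :=
  if fintype.split j is inl _ then `[a, b]%classic else `[0, B]%classic.
pose A := [set z : 'rV[R]_(N + N) | forall j, box j (z ord0 j)].
have AP z : A z <-> (forall i, a <= X z i <= b) /\ (forall i, 0 <= W z i <= B).
  split=> [Az|[Xz Wz] j].
    split=> i; [have := Az (lshift N i)|have := Az (rshift N i)]; rewrite /box.
      by rewrite (unsplitK (inl i)) /= in_itv.
    by rewrite (unsplitK (inr i)) /= in_itv.
  by rewrite /box; case: splitP => i ji; rewrite /= in_itv /=;
    [have := Xz i|have := Wz i]; rewrite /X /W; congr (_ <= z _ _ <= _); apply/val_inj.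
have cA : compact A.
  apply: (@rV_compact R _ box) => j.
  by rewrite /box; case: fintype.split => _; exact: segment_compact.
have cF : continuous F.
  have addc : continuous (fun z : R * R => z.1 + z.2) by exact: add_continuous.
  apply: (@continuous_big _ _ _ 0 xpredT addc) => k _ z.
  apply: (@continuous_comp _ _ _ (fun z => u k - P z k) (fun r : R => r ^+ 2));
    last exact: exprn_continuous.
  apply: continuousB; first exact: cst_continuous.
  apply: (@continuous_big _ _ _ 0 xpredT addc) => i _ {}z.
  apply: (@continuousM _ _ (fun z => W z i) (fun z => X z i ^+ k)); first exact: coord_continuous.
  apply: (@continuous_comp _ _ _ (fun z => X z i) (fun r : R => r ^+ k));
    first exact: coord_continuous.
  exact: exprn_continuous.
pose Z x w : 'rV[R]_(N + N) := 
  \row_j match fintype.split j with inl i => x i | inr i => w i end.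
have XZ x w i : X (Z x w) i = x i by rewrite /X mxE (unsplitK (inl i)).
have WZ x w i : W (Z x w) i = w i by rewrite /W mxE (unsplitK (inr i)).
pose z0 := Z (fun=> a) (fun=> 0).
have Az0 : A z0 by apply/AP; split=> i; rewrite ?XZ ?WZ lexx.
have Fz0 : F z0 = Q.
  apply: eq_bigr => k _; rewrite /P big1 ?subr0// => i _.
  by rewrite WZ mul0r.
have A0 : A !=set0 by exists z0.
have [z /set_mem /AP[Xz Wz] zmin] := @EVT_min_rV _ _ _ _ A0 cA (continuous_subspaceT cF).
exists (P z).
  by exists (X z), (W z); split=> // i; case/andP: (Wz i).
move=> q [x [w [xab w0 qE]]].
have -> : \sum_(k < m) (u k - q k) ^+ 2 = F (Z x w).
  apply: eq_bigr => k _; rewrite qE//; congr ((_ - _) ^+ 2).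
  by apply: eq_bigr => i _; rewrite XZ WZ.
case: (pselect (forall i, w i <= B)) => [wB|/existsNP[i /negP]].
  by apply/zmin/mem_set/AP; split=> i; rewrite ?XZ ?WZ ?w0 ?wB ?xab.
rewrite -ltNge => Bw; apply: (le_trans (zmin _ (mem_set Az0))); rewrite Fz0.
case: (posnP m) => [m0|m0].
  rewrite /Q big1 => [|[k km]]; last by exfalso; rewrite m0 in km.
  by apply: sumr_ge0 => k _; rewrite sqr_ge0.
have sw : w i <= \sum_i w i by rewrite (bigD1 i)//= lerDl sumr_ge0.
rewrite /F (bigD1 (Ordinal m0))//=; set r := \sum_(_ < _ | _) _.
have r0 : 0 <= r by apply: sumr_ge0 => k _; rewrite sqr_ge0.
have -> : P (Z x w) 0%N = \sum_i w i by apply: eq_bigr => j _; rewrite WZ mulr1.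
set s := \sum_i w i in sw *.
have hs : Q + 1 <= s - u 0%N.
  by have := ler_norm (u 0%N); move: Bw sw; rewrite /B; lra.
have hs2 : (Q + 1) ^+ 2 <= (u 0%N - s) ^+ 2.
  by rewrite -[leRHS]sqrrN opprB ler_sqr// nnegrE; lra.
apply: (le_trans _ (lerD hs2 r0)); rewrite addr0 sqrrD expr1n mulr1.
by have := sqr_ge0 Q; lra.
Qed.

(** Minimality in the direction of each moment vector makes the polynomial with coefficients [- r k]
    nonnegative on [[a, b]], so by positivity [r] pairs nonpositively with [u]. Shrinking [p] shows
    that [r] pairs nonnegatively with [p]. As [r = u - p], its squared norm is at most 0. *)
Lemma positive_on_moment_cone {R : realType} (a b : R) (u : seq R) : a <= b ->
  positive_on a b u -> moment_cone a b (size u) (nth 0 u).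
Proof.
move=> ab upos; set m := size u.
have [p pC pmin] := moment_cone_closest _ _ m (nth 0 u) ab.
pose r k := u`_k - p k.
have expand (y : nat -> R) (e : R) : \sum_(k < m) (r k + e * y k) ^+ 2 =
    \sum_(k < m) r k ^+ 2 + (e * (\sum_(k < m) r k * y k) *+ 2 + e ^+ 2 * \sum_(k < m) y k ^+ 2).
  rewrite !mulr_sumr -sumrMnl -!big_split /=; apply: eq_bigr => k _.
  by ring.
have min_dir (y : nat -> R) :
    (forall e, 0 <= e <= 1 -> moment_cone a b m (fun k => p k - e * y k)) ->
    0 <= \sum_(k < m) r k * y k.
  move=> hy; apply: (@quadratic_ge0 _ _ (\sum_(k < m) y k ^+ 2)).
    by apply: sumr_ge0 => k _; rewrite sqr_ge0.
  move=> e e01; have := pmin _ (hy e e01); rewrite -/r.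
  under [X in _ <= X]eq_bigr do rewrite opprB addrA addrAC -/(r _).
  by rewrite expand lerDl.
have r_le0 y : a <= y <= b -> 0 <= \sum_(k < m) r k * - y ^+ k.
  move=> yab; apply: (min_dir (fun k => - y ^+ k)) => e /andP[e0 _].
  have -> : (fun k => p k - e * - y ^+ k) = (fun k => p k + e * y ^+ k).
    by apply/funext => k; rewrite mulrN opprK.
  exact: moment_coneD.
have rp : 0 <= \sum_(k < m) r k * p k.
  apply: min_dir => e /andP[_ e1].
  have -> : (fun k => p k - e * p k) = (fun k => (1 - e) * p k).
    by apply/funext => k; rewrite mulrBl mul1r.
  by apply: moment_coneZ => //; rewrite subr_ge0.
have := upos (\poly_(k < m) - r k) (size_poly _ _).
have hor x : a <= x <= b -> 0 <= (\poly_(k < m) - r k).[x].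
  move=> xab; rewrite horner_poly; move: (r_le0 x xab).
  by under eq_bigr do rewrite mulrN -mulNr.
move=> /(_ hor) ru.
have rr : \sum_(k < m) r k ^+ 2 = 0.
  apply/eqP; rewrite eq_le sumr_ge0 ?andbT => [|k _]; last by rewrite sqr_ge0.
  have -> : \sum_(k < m) r k ^+ 2 =
      - (\sum_(k < m) (\poly_(k < m) - r k)`_k * u`_k) - \sum_(k < m) r k * p k.
    rewrite -sumrN -sumrB; apply: eq_bigr => k _.
    by rewrite coef_poly ltn_ord mulNr opprK -mulrBr.
  by rewrite -opprD oppr_le0 addr_ge0.
case: pC => x [w [xab w0 pE]]; exists x, w; split=> // k km; rewrite -pE//.
have /eqP := rr; rewrite psumr_eq0 => [|i _]; last by rewrite sqr_ge0.
move=> /allP /(_ (Ordinal km)); rewrite mem_index_enum => /(_ isT) /=.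
by rewrite sqrf_eq0 subr_eq0 => /eqP.
Qed.

(** * Finitely supported representing measures *)

Lemma ind1x2_set_nonempty {R : realType} (u : seq R) :
  positive_on01 u -> exists d, ind1x2_set u d.
Proof.
move=> [a [b [a0 ab b1 /(positive_on_moment_cone _ _ _ (ltW ab))]]].
move=> [x [w [xab w0 uE]]]; set N := (size u).+1 in x w xab w0 uE.
pose x' i := x (inord i); pose w' i := w (inord i).
have w'0 i : (i < N)%N -> 0 <= w' i by rewrite w0.
(* Atoms may coincide or carry no mass, whereas [fin_supp] asks for distinct points of positive
   mass. *)
pose S := undup [seq x i | i <- enum 'I_N & 0 < w i].
have SP i : 0 < w i -> x i \in S.
  by move=> wi; rewrite mem_undup map_f// mem_filter wi mem_enum.
have mu0 (A : set R) : (forall y, y \in S -> ~ A y) -> atomic N x' w' A = 0%E.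
  move=> AS; rewrite atomicE// big1// => i _; rewrite /w' /x' inord_val.
  case: (ltgtP 0 (w i)) => [/SP xS||<-]; last by rewrite mul0r.
    by rewrite indicE memNset ?mulr0//; exact: AS.
  by rewrite ltNge w0.
exists (ind1x2_supp S), (atomic N x' w'), S; split=> //.
  exists a, b; split=> //; apply: atomic_Mab => // [i _|k ku]; first exact: xab.
  by rewrite uE//; apply: eq_bigr => i _; rewrite /w' /x' inord_val.
split; first exact: undup_uniq.
  move=> y; split=> [|muy].
    rewrite mem_undup => /mapP[i]; rewrite mem_filter => /andP[wi _] ->.
    rewrite atomicE// lte_fin (bigD1 i)//= /w' /x' inord_val indicE mem_set//.
    rewrite mulr1 ltr_pwDl// sumr_ge0// => j _.
    by rewrite mulr_ge0// indicE ler0n.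
  apply/negPn/negP => yS; move: muy; rewrite mu0 ?ltxx// => z zS /= zy.
  by rewrite zy (negbTE yS) in zS.
by apply: mu0 => y yS; apply.
Qed.

(** Nonemptiness rules out the default value 0 of [ind1x2], so the minimum is attained. *)
Lemma ind1x2P {R : realType} (u : seq R) : positive_on01 u ->
  exists (mu : {measure set (measurableTypeR R) -> \bar R}) (S : seq R),
    [/\ M1 u mu, fin_supp mu S & ind1x2 u = ind1x2_supp S].
Proof.
move=> /ind1x2_set_nonempty[d ud]; rewrite /ind1x2.
case: pselect => [h|[]]; last by exists d; apply/asboolP.
by case: ex_minnP => m /asboolP[mu [S [? ? ?]]] _; exists mu, S.
Qed.

(** * Strict inequality and equality for [t_1] *)

Lemma big_subset_seq {R : nmodType} {I : eqType} (S T : seq I) (f : I -> R) :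
  uniq S -> uniq T -> {subset S <= T} ->
  \sum_(x <- T) (if x \in S then f x else 0) = \sum_(x <- S) f x.
Proof.
move=> uS uT ST; rewrite -big_mkcond -big_filter; apply: perm_big.
apply: uniq_perm => //; first exact: filter_uniq.
by move=> x; rewrite mem_filter andb_idr//; exact: ST.
Qed.

(** [u] lists moments of [x^(k+1) w], whose integral of [1/x] is the right-hand side. The index
    exceeds [size u], which leaves room for a perturbation that keeps these moments and lowers the
    integral by [e]. *)
Lemma t_1_lt_atomic {R : realType} (a : R) (S : seq R) (w : R -> R) (k : nat) (u : seq R) :
  0 < a -> a < 1 -> uniq S -> (forall x, x \in S -> a <= x <= 1) ->
  (forall x, x \in S -> 0 < w x) ->
  (forall j, (j < size u)%N -> u`_j = \sum_(x <- S) w x * x ^+ (k + j).+1) ->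
  (size u < ind1x2_supp S)%N ->
  (t_1 u < (\sum_(x <- S) w x * x ^+ k)%:E)%E.
Proof.
move=> a0 a1 uS Sa w0 uE uS2.
pose xs := sort <=%O S.
have pxs : perm_eq xs S by rewrite perm_sort.
have sxs : sorted <%O xs.
  by rewrite lt_sorted_uniq_le (perm_uniq pxs) uS /= sort_sorted//; exact: le_total.
have xs01 x : x \in xs -> 0 < x <= 1.
  by rewrite (perm_mem pxs) => /Sa /andP[ax ->]; rewrite (lt_le_trans a0 ax).
have xsind : ind1x2_supp xs = ind1x2_supp S.
  by rewrite /ind1x2_supp (perm_mem pxs) (perm_size (perm_filter _ pxs)).
rewrite -xsind in uS2.
(* [P] has [(size u).+1] nodes, which makes the Lagrange weights exact in degrees 0 to [size u]. *)
have [P [uP sP P1 Pge Podd]] := interlacing _ _ sxs xs01 uS2.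
have {}Pge y : y \in P -> a <= y.
  by apply: Pge => x; rewrite (perm_mem pxs) => /Sa /andP[].
have P0 y : y \in P -> 0 < y by move=> /Pge; exact: lt_le_trans.
pose l x := \prod_(y <- P | y != x) (y / (y - x)).
(* The factor [x] in [g] raises degrees by one: the [j]-th moment meets degree [j + 1], which is
   killed, and the integral of [1/x] meets degree 0. *)
pose f x := w x * x ^+ k.+1; pose g x := if x \in P then - (l x * x) else 0.
have f0 x : x \in S -> 0 < f x.
  move=> xS; rewrite mulr_gt0 ?w0// exprn_gt0//.
  by case/andP: (Sa _ xS) => ax _; exact: lt_le_trans ax.
have [e e0 fg0] := perturbation_ge0 S f g f0.
pose T := undup (S ++ P).
pose om x := (if x \in S then f x else 0) + e * g x.
have sum_om (h : R -> R) : \sum_(x <- T) om x * h x =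
    \sum_(x <- S) f x * h x - e * \sum_(x <- P) x * h x * l x.
  transitivity (\sum_(x <- T) (if x \in S then f x * h x else 0)
      + \sum_(x <- T) (if x \in P then - (e * (x * h x * l x)) else 0)).
    rewrite -big_split /=; apply: eq_bigr => x _; rewrite /om /g mulrDl.
    by case: ifP => _; case: ifP => _; ring.
  rewrite !big_subset_seq ?undup_uniq//.
  - by rewrite sumrN mulr_sumr.
  - by move=> x xP; rewrite mem_undup mem_cat xP orbT.
  - by move=> x xS; rewrite mem_undup mem_cat xS.
have -> : \sum_(x <- S) w x * x ^+ k = \sum_(x <- T) om x * x^-1 + e.
  rewrite sum_om.
  have -> : \sum_(x <- P) x * x^-1 * l x = 1.
    rewrite -[RHS](lagrange_at0 P 0 uP) ?sP// big_seq [RHS]big_seq.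
    by apply: eq_bigr => x /P0 x0; rewrite divff ?gt_eqF.
  rewrite mulr1 subrK big_seq [RHS]big_seq; apply: eq_bigr => x /Sa /andP[ax _].
  by rewrite /f exprSr mulrA mulfK// gt_eqF// (lt_le_trans a0).
apply: (@le_lt_trans _ _ (\sum_(x <- T) om x * x^-1)%:E); last by rewrite lte_fin ltrDl.
apply: (@t_1_le _ a) => //.
- by move=> x; rewrite mem_undup mem_cat => /orP[/Sa//|xP]; rewrite Pge ?P1.
(* On [S] the choice of [e] gives the sign; a node off [S] has an odd number of nodes below it, so
   its Lagrange weight is at most 0. *)
- move=> x; rewrite /om mem_undup mem_cat; case: ifP => [xS _|xS /= xP]; first exact: fg0.
  rewrite add0r mulr_ge0 ?(ltW e0)// /g xP -mulNr mulr_ge0 ?(ltW (P0 _ xP))//.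
  have := lagrange_weight_sign P x P0; rewrite -signr_odd Podd ?mulN1r//.
  by rewrite (perm_mem pxs) xS.
move=> j ju; rewrite uE// sum_om.
have -> : \sum_(x <- P) x * x ^+ j * l x = 0.
  have := lagrange_at0 P j.+1 uP; rewrite sP ltnS => /(_ ju) lagr.
  by rewrite -[RHS]lagr; apply: eq_bigr => x _; rewrite exprS.
by rewrite mulr0 subr0; apply: eq_bigr => x _; rewrite /f -mulrA -exprD addSn.
Qed.

(* [q] interpolates [1/x] at [S]: twice at the points of ]0, 1[, once at 1. *)
Lemma inverse_interpolant {R : realType} (S : seq R) :
  (forall x, x \in S -> 0 < x <= 1) ->
  exists q : {poly R}, [/\ (size q <= ind1x2_supp S)%N,
    forall t, 0 < t <= 1 -> q.[t] <= t^-1 & forall x, x \in S -> x * q.[x] = 1].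
Proof.
move=> S01; pose S' := [seq x <- S | (0 < x) && (x < 1)].
pose L (x : R) : {poly R} := 1 - x^-1 *: 'X.
have LE x t : (L x).[t] = 1 - x^-1 * t by rewrite !hornerE.
have sL x : (size (L x) <= 2)%N.
  apply: (leq_trans (size_polyD _ _)); rewrite geq_max size_poly1 size_polyN /=.
  by apply: (leq_trans (size_scale_leq _ _)); rewrite size_polyX.
have sL2 x : (size (L x ^+ 2) <= 3)%N.
  rewrite expr2; apply: (leq_trans (size_polyMleq _ _)) => /=.
  by have := sL x; case: (size (L x)) => [|[|[|]]].
pose r : {poly R} := (\prod_(x <- S') L x ^+ 2) * L 1 ^+ (1 \in S).
have sr : (size r <= (ind1x2_supp S).+1)%N.
  rewrite /r; apply: (leq_trans (size_polyMleq _ _)) => /=.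
  have s1 : (size (L 1%R ^+ ((1%R : R) \in S))%R <= ((1%R : R) \in S).+1)%N.
    by case: ((1 : R) \in S); rewrite ?expr1 ?expr0 ?size_poly1// sL.
  rewrite -subn1 leq_subLR (leq_trans (leq_add (size_prod_le 2 _ _ sL2) s1))//.
  by rewrite addSn addnS add1n.
(* [r] equals 1 at 0, so ['X] divides [1 - r]; the division lowers the size bound by one. *)
have [q qE] : exists q, 1 - r = q * ('X - 0%:P).
  apply/factor_theorem; rewrite /root !hornerE horner_prod big1 => [|x _].
    by case: ((1 : R) \in S); rewrite ?expr1 ?expr0 !hornerE; apply/eqP; ring.
  by rewrite horner_exp LE mulr0 subr0 expr1n.
rewrite subr0 in qE.
have qx t : t * q.[t] = 1 - r.[t].
  by rewrite mulrC -hornerMX -qE hornerD hornerN hornerC.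
exists q; split.
- have [->|q0] := eqVneq q 0; first by rewrite size_poly0.
  rewrite -ltnS -size_mulX// -qE.
  apply: (leq_trans (size_polyD _ _)); rewrite geq_max size_poly1 size_polyN sr.
  by rewrite ltnS leq0n.
- move=> t /andP[t0 t1]; rewrite -(ler_pM2l t0) divff ?gt_eqF// qx.
  rewrite lerBlDr lerDl hornerM horner_prod mulr_ge0//.
    by apply: prodr_ge0 => x _; rewrite horner_exp sqr_ge0.
  by case: ((1 : R) \in S); rewrite ?expr1 ?expr0 ?LE ?hornerC ?ler01// invr1 mul1r subr_ge0.
move=> x xS; rewrite qx; have /andP[x0 x1] := S01 x xS.
suff -> : r.[x] = 0 by rewrite subr0.
rewrite hornerM; have [xlt1|] := ltP x 1.
  rewrite horner_prod (big_rem x)/=; last by rewrite mem_filter x0 xlt1.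
  by rewrite horner_exp LE mulVf ?gt_eqF// subrr expr0n !mul0r.
move=> x1'; have x1E : x = 1 by apply/eqP; rewrite eq_le x1.
by rewrite -x1E xS expr1 LE mulVf ?gt_eqF// subrr mulr0.
Qed.

(** The measure [x^(k+1) w] bounds [t_1 u] from above and the interpolant [q] from below; the bounds
    meet because [q] is [1/x] on [S]. *)
Lemma t_1_eq_atomic {R : realType} (a : R) (S : seq R) (w : R -> R) (k : nat) (u : seq R) :
  0 < a -> a < 1 -> (forall x, x \in S -> a <= x <= 1) ->
  (forall x, x \in S -> 0 < w x) -> size u = ind1x2_supp S ->
  (forall j, (j < size u)%N -> u`_j = \sum_(x <- S) w x * x ^+ (k + j).+1) ->
  t_1 u = (\sum_(x <- S) w x * x ^+ k)%:E.
Proof.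
move=> a0 a1 Sa w0 su uE; apply/eqP; rewrite eq_le; apply/andP; split.
  have -> : \sum_(x <- S) w x * x ^+ k = \sum_(x <- S) (w x * x ^+ k.+1) * x^-1.
    rewrite big_seq [RHS]big_seq; apply: eq_bigr => x /Sa /andP[ax _].
    by rewrite exprSr mulrA mulfK// gt_eqF// (lt_le_trans a0).
  apply: (@t_1_le _ a) => // [x xS|j ju].
    rewrite mulr_ge0 ?(ltW (w0 _ xS))// exprn_ge0//.
    by case/andP: (Sa _ xS) => ax _; rewrite ltW// (lt_le_trans a0).
  by rewrite uE//; apply: eq_bigr => x _; rewrite -mulrA -exprD addSn.
have S01 x : x \in S -> 0 < x <= 1.
  by move=> /Sa /andP[ax ->]; rewrite (lt_le_trans a0 ax).
have [q [sq qle qS]] := inverse_interpolant S S01.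
have -> : \sum_(x <- S) w x * x ^+ k = \sum_(j < size u) q`_j * u`_j.
  (* On [S] the factor [x * q.[x]] is 1; inserting it and expanding [q] produces the moments in
     [u]. *)
  transitivity (\sum_(j < size u) \sum_(x <- S) (w x * x ^+ k) * (x * (q`_j * x ^+ j))).
    rewrite exchange_big /= big_seq [RHS]big_seq; apply: eq_bigr => x xS.
    by rewrite -!mulr_sumr -horner_coef_wide ?su// qS// mulr1.
  apply: eq_bigr => j _; rewrite uE// mulr_sumr; apply: eq_bigr => x _.
  by rewrite exprS exprD; ring.
by apply: t_1_ge; rewrite ?su.
Qed.

(* K = ind_1(s) is encoded as ind1x2 = 2K; N = 2K - 1, so
   k in [n-N, n-1]  <->  n+1 <= k + 2K /\ k <= n-1,
   k in [0, n-N-1]  <->  k + 2K <= n,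
   (s_{k+1},...,s_{k+N+1}) has length N+1 = 2K. *)
Theorem theorem8p6 (R : realType) (n : nat) (s : nat -> R) :
  (forall i, (i <= n)%N -> 0 <= s i) ->
  positive_on01 [seq s i | i <- iota 0 n.+1] ->
  let K2 := ind1x2 [seq s i | i <- iota 0 n.+1] in
  (forall k : nat, (n.+1 <= k + K2)%N -> (k < n)%N ->
     (t_1 (subseqR s k.+1 (n - k)) < (s k)%:E)%E) /\
  (forall k : nat, (k + K2 <= n)%N ->
     (s k)%:E = t_1 (subseqR s k.+1 K2)).
Proof.
move=> _ /ind1x2P[mu [S [muM muS ->]]] /=; have [uS _ _] := muS.
have [|a [w [a0 a1 Sa w0]]] := fin_supp_moments _ _ _ _ muM muS.
  by rewrite size_map size_iota.
rewrite size_map size_iota => sE'.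
have sE k : (k <= n)%N -> s k = \sum_(x <- S) w x * x ^+ k.
  by move=> kn; rewrite -sE'// (nth_map 0%N) ?size_iota// nth_iota.
have subE k l j : (j < l)%N -> (subseqR s k.+1 l)`_j = s (k + j).+1.
  by move=> jl; rewrite (nth_map 0%N) ?size_iota// nth_iota// addSn.
have sz i l : size (subseqR s i l) = l by rewrite size_map size_iota.
split=> k.
  move=> nk kn; rewrite (sE k (ltnW kn)).
  (* There are [n - k] moments after [s k], fewer than the doubled index because [n < k + 2K]. *)
  apply: (t_1_lt_atomic a) => //; rewrite sz; last by rewrite ltn_subLR// ltnW.
  by move=> j jn; rewrite subE// sE// -ltn_subRL.
move=> kn; rewrite sE ?(leq_trans (leq_addr _ _) kn)//.
rewrite (t_1_eq_atomic a S w k)//; rewrite sz// => j jK.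
by rewrite subE// sE// (leq_trans _ kn)// -addnS leq_add2l.
Qed.
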